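(* Assume that $4\le l\le 40$ and $l$ is even. Then there exists an algebraic modular form $f_{l,+}\in\mathcal{H}_{l,+}^{\Gamma}$ with integer coefficients (i.e. $f_{l,+}\in\mathbb{Z}[x_1,x_2,x_3]$) such that $$f_{l,+}(x)\equiv \mathrm{Nm}(x)^{l/2} \pmod 2$$ as polynomials in $\mathbb{Z}[x_1,x_2,x_3]$, where $\mathrm{Nm}(x)=3(x_1^2+x_2^2+x_3^2)-2(x_1x_2+x_2x_3+x_3x_1)$.
   Context: Let $D=\mathbb{Q}+\mathbb{Q}i+\mathbb{Q}j+\mathbb{Q}ij$ be the quaternion algebra over $\mathbb{Q}$ with $i^2=j^2=-1$, $ij=-ji$, with involution $\iota(a_0+a_1i+a_2j+a_3ij)=a_0-a_1i-a_2j-a_3ij$, $\mathrm{Tr}(x)=x+\iota(x)$, $\mathrm{Nm}(x)=x\,\iota(x)$. Let $\mathcal{O}=\mathbb{Z}+\mathbb{Z}i+\mathbb{Z}j+\mathbb{Z}w$ with $w=(1+i+j+ij)/2$ (the Hurwitz maximal order). Let $V_D=\{x\in D\mid \mathrm{Tr}(x)=0\}$, with basis $\mathbf{b}_1=-i+j+ij$, $\mathbf{b}_2=i-j+ij$, $\mathbf{b}_3=i+j-ij$; identify $x_1\mathbf{b}_1+x_2\mathbf{b}_2+x_3\mathbf{b}_3\in V_D$ with the row vector $x=(x_1,x_2,x_3)$, so that $\mathrm{Nm}(x)=3(x_1^2+x_2^2+x_3^2)-2(x_1x_2+x_2x_3+x_3x_1)$. For $g\in D^\times$ let $\mathcal{F}(g)\in\mathrm{SL}_3(\mathbb{Q})$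 be the matrix such that the map $x\mapsto g^{-1}xg$ on $V_D$ is $x\mapsto x\,\mathcal{F}(g)$ on row vectors. Put $\Gamma=\mathcal{F}(\mathcal{O}^\times)$, a finite group of order $12$. For $l\ge 0$ let $\mathcal{A}_l$ be the $\mathbb{Q}$-space of homogeneous polynomials of degree $l$ in $\mathbb{Q}[x_1,x_2,x_3]$ (including $0$), let $\Delta_Q=\frac12\left(\frac{\partial^2}{\partial x_1^2}+\frac{\partial^2}{\partial x_2^2}+\frac{\partial^2}{\partial x_3^2}+\frac{\partial^2}{\partial x_1\partial x_2}+\frac{\partial^2}{\partial x_2\partial x_3}+\frac{\partial^2}{\partial x_3\partial x_1}\right)$, let $\mathcal{H}_l=\{f\in\mathcal{A}_l\mid\Delta_Qf=0\}$, and let $\mathcal{H}_l^\Gamma=\{f\in\mathcal{H}_l\mid f(x\gamma)=f(x)\ \forall\gamma\in\Gamma\}$; its elements are called algebraic modular forms of degree $l$. Let $\mathfrak{T}_2=\{\mathcal{F}(y)\mid y\in\mathcal{O},\ \mathrm{Nm}(y)=2\}$ and define $T_2$ on $\mathcal{H}_l^\Gamma$ by $(T_2f)(x)=\sum_{\gamma\in\Gamma\backslash\mathfrak{T}_2}f(x\gamma^{-1})$. Set $\mathcal{H}_{l,+}^\Gamma=\{f\in\mathcal{H}_l^\Gamma\mid T_2f=(-1)^lf\}$. *)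

(* Defs.v *)
From HB Require Import structures.
From mathcomp Require Import all_boot all_order all_algebra.
From mathcomp Require Import boolp classical_sets fsbigop.
From mathcomp Require Import mpoly.
From mathcomp Require Import ring.

Set Implicit Arguments.
Unset Strict Implicit.
Unset Printing Implicit Defensive.

Import Order.TTheory GRing.Theory Num.Theory.
Local Open Scope ring_scope.

(* An element a0 + a1 i + a2 j + a3 ij is the row (a0, a1, a2, a3). *)
Definition quat : Type := 'rV[rat]_4.

HB.instance Definition _ := GRing.Lmodule.on quat.

Definition mkq (a0 a1 a2 a3 : rat) : quat :=
  \row_(n < 4) [:: a0; a1; a2; a3]`_n.

Definition qc (n : nat) (x : quat) : rat := x 0 (inord n).

Lemma mkqE a0 a1 a2 a3 n :
  (n < 4)%N -> qc n (mkq a0 a1 a2 a3) = [:: a0; a1; a2; a3]`_n.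
Proof. by move=> hn; rewrite /qc mxE inordK. Qed.

Lemma qcP (x y : quat) :
  [/\ qc 0 x = qc 0 y, qc 1 x = qc 1 y, qc 2 x = qc 2 y & qc 3 x = qc 3 y] ->
  x = y.
Proof.
case=> h0 h1 h2 h3; apply/rowP => -[n hn].
have -> : Ordinal hn = inord n by apply: val_inj; rewrite /= inordK.
by move: n hn => [|[|[|[|]]]].
Qed.

Lemma qcD n (x y : quat) : qc n (x + y) = qc n x + qc n y.
Proof. by rewrite /qc mxE. Qed.
Lemma qcN n (x : quat) : qc n (- x) = - qc n x.
Proof. by rewrite /qc mxE. Qed.
Lemma qcZ n a (x : quat) : qc n (a *: x) = a * qc n x.
Proof. by rewrite /qc mxE. Qed.
Lemma qc0 n : qc n 0 = 0.
Proof. by rewrite /qc mxE. Qed.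

Definition mulq (x y : quat) : quat :=
  mkq
    (qc 0 x * qc 0 y - qc 1 x * qc 1 y - qc 2 x * qc 2 y - qc 3 x * qc 3 y)
    (qc 0 x * qc 1 y + qc 1 x * qc 0 y + qc 2 x * qc 3 y - qc 3 x * qc 2 y)
    (qc 0 x * qc 2 y - qc 1 x * qc 3 y + qc 2 x * qc 0 y + qc 3 x * qc 1 y)
    (qc 0 x * qc 3 y + qc 1 x * qc 2 y - qc 2 x * qc 1 y + qc 3 x * qc 0 y).

Definition oneq : quat := mkq 1 0 0 0.

Ltac qsimp := rewrite ?(qcD, qcN, qcZ, qc0, mkqE) //=.
Ltac qring := apply: qcP; split; rewrite /mulq /oneq; do ?qsimp; ring.

Lemma mulqA : associative mulq. Proof. by move=> x y z; qring. Qed.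
Lemma mul1q : left_id oneq mulq. Proof. by move=> x; qring. Qed.
Lemma mulq1 : right_id oneq mulq. Proof. by move=> x; qring. Qed.
Lemma mulqDl : left_distributive mulq +%R. Proof. by move=> x y z; qring. Qed.
Lemma mulqDr : right_distributive mulq +%R. Proof. by move=> x y z; qring. Qed.
Lemma oneq_neq0 : oneq != 0 :> quat.
Proof.
by apply/eqP => /(congr1 (qc 0)); rewrite /oneq; qsimp.
Qed.

HB.instance Definition _ := GRing.Zmodule_isNzRing.Build quat
  mulqA mul1q mulq1 mulqDl mulqDr oneq_neq0.

Lemma qcM (x y : quat) : x * y = mulq x y. Proof. by []. Qed.
Lemma qc1 : 1 = oneq :> quat. Proof. by []. Qed.

Lemma scaleqAl (a : rat) (x y : quat) : a *: (x * y) = (a *: x) * y.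
Proof. by rewrite !qcM; qring. Qed.
HB.instance Definition _ := GRing.Lmodule_isLalgebra.Build rat quat scaleqAl.

Lemma scaleqAr (a : rat) (x y : quat) : a *: (x * y) = x * (a *: y).
Proof. by rewrite !qcM; qring. Qed.
HB.instance Definition _ := GRing.Lalgebra_isAlgebra.Build rat quat scaleqAr.

(* The involution iota, and the trace and norm as elements of the algebra. *)
Definition qconj (x : quat) : quat :=
  mkq (qc 0 x) (- qc 1 x) (- qc 2 x) (- qc 3 x).
Definition qTr (x : quat) : quat := x + qconj x.
Definition qNm (x : quat) : quat := x * qconj x.

Definition sqn (x : quat) : rat :=
  qc 0 x ^+ 2 + qc 1 x ^+ 2 + qc 2 x ^+ 2 + qc 3 x ^+ 2.

Lemma qNmE x : qNm x = (sqn x)%:A.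
Proof. by rewrite /qNm qcM qc1 /sqn /qconj; qring. Qed.

Lemma qTrC x y : qTr (x * y) = qTr (y * x).
Proof. by rewrite /qTr !qcM /qconj; qring. Qed.

Lemma sqn_eq0 x : (sqn x == 0) = (x == 0).
Proof.
apply/eqP/eqP => [|->]; last by rewrite /sqn !qc0; ring.
move/eqP; rewrite /sqn !paddr_eq0 ?addr_ge0 ?sqr_ge0 // !sqrf_eq0.
by case/andP=> /andP[/andP[/eqP? /eqP?] /eqP?] /eqP?; apply: qcP; rewrite !qc0.
Qed.

Definition qunit : pred quat := [pred x | x != 0].
Definition qinv (x : quat) : quat := (sqn x)^-1 *: qconj x.

Lemma qinv0 : qinv 0 = 0.
Proof. by rewrite /qinv /qconj; qring. Qed.

Lemma mulVq : {in qunit, left_inverse 1 qinv *%R}.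
Proof.
move=> x; rewrite inE -sqn_eq0 => nz.
rewrite -scalerAl (_ : qconj x * x = (sqn x)%:A) ?scalerA ?mulVf ?scale1r //.
by rewrite qcM qc1 /sqn /qconj; qring.
Qed.

Lemma mulqV : {in qunit, right_inverse 1 qinv *%R}.
Proof.
move=> x; rewrite inE -sqn_eq0 => nz.
by rewrite -scalerAr -[x * _]/(qNm x) qNmE scalerA mulVf ?scale1r.
Qed.

Lemma qunitP (x y : quat) : y * x = 1 /\ x * y = 1 -> qunit x.
Proof.
case=> yx _; apply/eqP => x0; move: yx; rewrite x0 mulr0 => /eqP.
by rewrite eq_sym oner_eq0.
Qed.

Lemma qinv_out : {in [predC qunit], qinv =1 id}.
Proof. by move=> x; rewrite !inE negbK => /eqP ->; rewrite qinv0. Qed.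

HB.instance Definition _ := GRing.NzRing_hasMulInverse.Build quat
  mulVq mulqV qunitP qinv_out.

Definition qi : quat := mkq 0 1 0 0.
Definition qj : quat := mkq 0 0 1 0.

Lemma quat_rel : [/\ qi ^+ 2 = -1, qj ^+ 2 = -1 & qi * qj = - (qj * qi)].
Proof. by rewrite !expr2 !qcM !qc1 /qi /qj; split; qring. Qed.

Lemma quat_basis a0 a1 a2 a3 :
  mkq a0 a1 a2 a3 = a0%:A + a1 *: qi + a2 *: qj + a3 *: (qi * qj).
Proof. by rewrite qcM qc1 /qi /qj; qring. Qed.

Definition qw : quat := 2%:R^-1 *: (1 + qi + qj + qi * qj).

(* The Hurwitz order O. *)
Definition hurwitz : set quat :=
  [set x | exists a b c d : int,
     x = a%:~R + b%:~R * qi + c%:~R * qj + d%:~R * qw]%classic.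

Definition hurwitz_units : set quat :=
  [set x | hurwitz x /\ exists2 y, hurwitz y & x * y = 1 /\ y * x = 1]%classic.

Definition qb1 : quat := - qi + qj + qi * qj.
Definition qb2 : quat := qi - qj + qi * qj.
Definition qb3 : quat := qi + qj - qi * qj.

(* The identification of Q^3 with the trace-zero quaternions, and its inverse
   (junk outside the trace-zero quaternions). *)
Definition vecV (x : 'rV[rat]_3) : quat :=
  x 0 (inord 0) *: qb1 + x 0 (inord 1) *: qb2 + x 0 (inord 2) *: qb3.

Definition coordV (v : quat) : 'rV[rat]_3 :=
  \row_(k < 3) [:: (qc 2 v + qc 3 v) / 2%:R; (qc 1 v + qc 3 v) / 2%:R;
                   (qc 1 v + qc 2 v) / 2%:R]`_k.

Lemma vecVE x : vecV x =
  mkq 0 (- x 0 (inord 0) + x 0 (inord 1) + x 0 (inord 2))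
        (x 0 (inord 0) - x 0 (inord 1) + x 0 (inord 2))
        (x 0 (inord 0) + x 0 (inord 1) - x 0 (inord 2)).
Proof. by rewrite /vecV /qb1 /qb2 /qb3 qcM /qi /qj; qring. Qed.

Lemma vecV_is_linear : linear vecV.
Proof.
by move=> a u v; rewrite !vecVE; apply: qcP; split; do ?qsimp;
  rewrite ?mxE; ring.
Qed.

Lemma coordV_is_linear : linear coordV.
Proof.
move=> a u v; apply/rowP => k; rewrite !mxE.
by case: k => -[|[|[|]]] //= _; rewrite !(qcD, qcZ); ring.
Qed.

Lemma vecVK : cancel vecV coordV.
Proof.
move=> x; apply/rowP => -[n hn].
have -> : Ordinal hn = inord n by apply: val_inj; rewrite /= inordK.
rewrite mxE vecVE inordK //.
by move: n hn => [|[|[|]]] //= _; qsimp; field.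
Qed.

Lemma qTr0P v : qTr v = 0 -> qc 0 v = 0.
Proof.
move/(congr1 (qc 0)); rewrite /qTr /qconj; do ?qsimp.
by move/eqP; rewrite -mulr2n mulrn_eq0 /= => /eqP.
Qed.

Lemma coordVK v : qTr v = 0 -> vecV (coordV v) = v.
Proof.
move/qTr0P => h; rewrite vecVE; apply: qcP.
by split; qsimp; rewrite ?h ?mxE ?inordK //=; field.
Qed.

Lemma qTr_vecV x : qTr (vecV x) = 0.
Proof. by rewrite vecVE /qTr /qconj; qring. Qed.

(* The matrix of x |-> g^-1 x g in the basis qb1, qb2, qb3, acting on rows. *)
Definition Fmx (g : quat) : 'M[rat]_3 :=
  lin1_mx (fun x => coordV (g^-1 * vecV x * g)).

Lemma Fmx_act g x : g != 0 -> vecV (x *m Fmx g) = g^-1 * vecV x * g.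
Proof.
move=> nz.
have lin_act : linear (fun y => coordV (g^-1 * vecV y * g)).
  move=> a u v.
  by rewrite vecV_is_linear mulrDr mulrDl -scalerAr -scalerAl coordV_is_linear.
pose H := GRing.isLinear.Build _ _ _ _ _ lin_act.
pose f : {linear _ -> _} := HB.pack (fun y => coordV (g^-1 * vecV y * g)) H.
rewrite /Fmx (mul_rV_lin1 f) /= coordVK //.
by rewrite -mulrA qTrC -mulrA divrr ?mulr1 ?qTr_vecV.
Qed.

Definition Gamma : set 'M[rat]_3 := (Fmx @` hurwitz_units)%classic.

Definition frakT2 : set 'M[rat]_3 :=
  (Fmx @` [set y | hurwitz y /\ qNm y = 2%:R])%classic.

(* The polynomial f(x M), where x = (x_1, x_2, x_3) is a row vector. *)
Definition mpact (M : 'M[rat]_3) (f : {mpoly rat[3]}) : {mpoly rat[3]} :=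
  f \mPo [tuple \sum_(i < 3) M i j *: 'X_i | j < 3].

Definition laplQ (f : {mpoly rat[3]}) : {mpoly rat[3]} :=
  2%:R^-1 *: (\sum_(i < 3) f^`M(i)^`M(i)
              + \sum_(i < 3) \sum_(j < 3 | (i < j)%N) f^`M(i)^`M(j)).

Definition harmonic (l : nat) : set {mpoly rat[3]} :=
  [set f | f \is l.-homog /\ laplQ f = 0]%classic.

Definition harmonicG (l : nat) : set {mpoly rat[3]} :=
  [set f | harmonic l f /\ forall g, Gamma g -> mpact g f = f]%classic.

Definition gcoset (g : 'M[rat]_3) : set 'M[rat]_3 :=
  [set u *m g | u in Gamma]%classic.

(* A finite sum over the set of cosets Gamma \ frakT2, evaluated at a chosen
   representative of each coset; for Gamma-invariant f the summand does not
   depend on the choice. *)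
Definition hecke2 (f : {mpoly rat[3]}) : {mpoly rat[3]} :=
  \sum_(C \in (gcoset @` frakT2)%classic) mpact (invmx (xget 1%:M C)) f.

Definition harmonicGplus (l : nat) : set {mpoly rat[3]} :=
  [set f | harmonicG l f /\ hecke2 f = (-1) ^+ l *: f]%classic.

Definition NmZ : {mpoly int[3]} :=
  let x1 := 'X_(inord 0) in let x2 := 'X_(inord 1) in let x3 := 'X_(inord 2) in
  3%:R * (x1 ^+ 2 + x2 ^+ 2 + x3 ^+ 2) - 2%:R * (x1 * x2 + x2 * x3 + x3 * x1).

Lemma NmZE (x : 'rV[rat]_3) :
  qNm (vecV x) = ((map_mpoly intr NmZ).@[fun i => x 0 i])%:A.
Proof.
rewrite qNmE vecVE /sqn; congr (_ *: _); qsimp.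
rewrite /NmZ !(rmorphB, rmorphD, rmorphM, rmorphXn, rmorph_nat) /=.
rewrite !map_mpolyX !mevalXU; ring.
Qed.

(* Main.v *)
(** Let [u] run over the six linear forms [x1, x2, x3, x1 - x2, x2 - x3,
    x3 - x1]; they are permuted up to sign by [Gamma] and by [F(1 + i)], their
    squares sum to [N = Nm], and every element of norm 2 of the Hurwitz order is
    a unit times [1 + i], so that [T_2] is a sum over a single coset. Hence every
    [T = sum_m e_m N^(h-m) S_m], [S_m] the sum of the [u^(2m)], is invariant under
    [Gamma] and fixed by [T_2]. Since
      [Delta_Q (N^k u^(2m)) = 2k(2k+4m+1) N^(k-1) u^(2m) + m(2m-1) N^k u^(2m-2)],
    [T] is harmonic as soon as the [e_m] satisfy a two-term recurrence. Modulo 4,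
    [S_0 = 6], [S_1 = N] and [S_2 = - N^2]; modulo 2, [S_3 = N^3] and
    [S_4 = N^4]. With the [e_m] made integral, their divisibility by powers of 2
    then yields [T = 2 D N^h + 4 D g] for a power [D] of 2, and [T / (2 D)] is the
    required form. *)
Require Import Defs.
From mathcomp Require Import all_boot all_order all_algebra.
From mathcomp Require Import boolp classical_sets fsbigop.
From mathcomp Require Import mpoly.
From mathcomp Require Import ssrZ zify.
From mathcomp Require Import ring.

Set Implicit Arguments.
Unset Strict Implicit.
Unset Printing Implicit Defensive.

Import Order.TTheory GRing.Theory Num.Theory.
Local Open Scope ring_scope.

(** * Even power sums of the six forms and their congruences modulo 4 and 2 *)

Section RootSums.
Variable R : comNzRingType.
Implicit Types (x y z : R) (e : nat -> int).

(** Up to sign these are the roots of type A_3, written with fourth coordinate 0. *)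
Definition root_forms x y z : seq R := [:: x; y; z; x - y; y - z; z - x].

Definition rootsum x y z m : R := \sum_(u <- root_forms x y z) u ^+ m.*2.

Definition zonalsum e h x y z : R :=
  \sum_(m < h.+1) (e m)%:~R * rootsum x y z 1 ^+ (h - m) * rootsum x y z m.

Lemma rootsum0 x y z : rootsum x y z 0 = 6%:R.
Proof. by rewrite /rootsum !big_cons big_nil; ring. Qed.

Lemma rootsum1 x y z : rootsum x y z 1 =
  3%:R * (x ^+ 2 + y ^+ 2 + z ^+ 2) - 2%:R * (x * y + y * z + z * x).
Proof. by rewrite /rootsum !big_cons big_nil; ring. Qed.

Lemma rootsum2_mod4 x y z :
  exists g, rootsum x y z 2 = 4%:R * g - rootsum x y z 1 ^+ 2.
Proof.
(* The witness is the expansion of (S_2 + N^2) / 4. *)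
exists (3%:R * (x ^+ 4 + y ^+ 4 + z ^+ 4)
  + 7%:R * (x ^+ 2 * y ^+ 2 + y ^+ 2 * z ^+ 2 + z ^+ 2 * x ^+ 2)
  - 4%:R * (x ^+ 3 * y + x * y ^+ 3 + y ^+ 3 * z + y * z ^+ 3
            + z ^+ 3 * x + z * x ^+ 3)
  - x * y * z * (x + y + z)).
by rewrite rootsum1 /rootsum !big_cons big_nil; ring.
Qed.

Lemma rootsum3_mod2 x y z :
  exists g, rootsum x y z 3 = rootsum x y z 1 ^+ 3 + 2%:R * g.
Proof.
(* The witness is the expansion of (S_3 - N^3) / 2, grouped by type of monomial. *)
exists (24%:R * (x ^+ 5 * y + x * y ^+ 5 + y ^+ 5 * z + y * z ^+ 5
                 + z ^+ 5 * x + z * x ^+ 5)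
  - 12%:R * (x ^+ 6 + y ^+ 6 + z ^+ 6)
  - 51%:R * (x ^+ 4 * y ^+ 2 + x ^+ 2 * y ^+ 4 + y ^+ 4 * z ^+ 2
             + y ^+ 2 * z ^+ 4 + z ^+ 4 * x ^+ 2 + z ^+ 2 * x ^+ 4)
  + 48%:R * (x ^+ 3 * y ^+ 3 + y ^+ 3 * z ^+ 3 + z ^+ 3 * x ^+ 3)
  - 9%:R * x * y * z * (x ^+ 3 + y ^+ 3 + z ^+ 3)
  + 30%:R * x * y * z * (x ^+ 2 * y + x * y ^+ 2 + y ^+ 2 * z + y * z ^+ 2
                         + z ^+ 2 * x + z * x ^+ 2)
  - 111%:R * x ^+ 2 * y ^+ 2 * z ^+ 2).
by rewrite rootsum1 /rootsum !big_cons big_nil; ring.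
Qed.

(** Squaring is additive modulo 2; it is applied to the summands u^(2m). *)
Lemma rootsum_double_mod2 x y z m :
  exists g, rootsum x y z m.*2 = rootsum x y z m ^+ 2 + 2%:R * g.
Proof.
rewrite /rootsum; elim: (root_forms x y z) => [|u s [g IHg]].
  by exists 0; rewrite !big_nil expr0n mulr0 addr0.
exists (g - u ^+ m.*2 * \sum_(v <- s) v ^+ m.*2).
rewrite !big_cons IHg -[m.*2.*2]muln2 exprM; ring.
Qed.

Lemma rootsum4_mod2 x y z :
  exists g, rootsum x y z 4 = rootsum x y z 1 ^+ 4 + 2%:R * g.
Proof.
have [g2 E2] := rootsum2_mod4 x y z; have [g4 E4] := rootsum_double_mod2 x y z 2.
exists (g4 + 8%:R * g2 ^+ 2 - 4%:R * g2 * rootsum x y z 1 ^+ 2).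
by rewrite E4 E2; ring.
Qed.

(* The terms of index 0 and 1 of a zonal sum are both multiples of N^h, and
   those of index 2, 3, 4 are congruent to multiples of N^h. *)
Definition zonal_congruence (D : int) (e : nat -> int) h :=
  [/\ (6 * e 0%N + e 1%N - e 2%N + e 3%N + e 4%N = 2 * D %[mod 4 * D])%Z,
      (D %| e 2%N)%Z, (2 * D %| e 3%N)%Z, (2 * D %| e 4%N)%Z &
      forall m, (4 < m <= h)%N -> (4 * D %| e m)%Z].

(** As S_2 is known modulo 4, a factor D in e_2 already puts its error into 4 D. S_3 and S_4 are
    known only modulo 2, hence the factor 2 D in e_3 and e_4; beyond that nothing is used about
    S_m. *)
Lemma zonalsum_mod (D : int) e h x y z :
    (2 <= h)%N -> (forall m, (h < m)%N -> e m = 0) -> zonal_congruence D e h ->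
  exists g, zonalsum e h x y z =
            (2 * D)%:~R * rootsum x y z 1 ^+ h + (4 * D)%:~R * g.
Proof.
move=> h2 e0 [/eqP]; rewrite eqz_mod_dvd => /dvdzP[q Eq].
move=> /dvdzP[q2 E2] /dvdzP[q3 E3] /dvdzP[q4 E4] Em.
set N := rootsum x y z 1; pose t m := (e m)%:~R * N ^+ (h - m) * rootsum x y z m.
have tail s : exists g, \sum_(5 <= m < s) t m = (4 * D)%:~R * g.
  elim: s => [|s [g IHs]]; first by exists 0; rewrite big_geq // mulr0.
  case: (ltnP s 5) => [s5 | s5]; first by exists 0; rewrite big_geq // mulr0.
  rewrite big_nat_recr //= IHs /t.
  case: (leqP s h) => [sh | hs].
    have /dvdzP[c ->] : (4 * D %| e s)%Z by apply: Em; rewrite s5 sh.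
    exists (g + c%:~R * N ^+ (h - s) * rootsum x y z s).
    by rewrite !(rmorphM, rmorph_nat) /=; ring.
  by exists g; rewrite e0 // !mul0r addr0.
(* Five zero terms are appended so that the indices 0 to 4 can be split off even when h < 4. *)
have -> : zonalsum e h x y z = \sum_(0 <= m < h.+1 + 5) t m.
  rewrite (big_cat_nat (n := h.+1)) ?leq_addr //= big_mkord.
  rewrite [X in _ + X]big_nat [X in _ + X]big1 ?addr0 // => m /andP[hm _].
  by rewrite /t e0 // !mul0r.
have {tail} [g5 Eg5] := tail (h.+1 + 5)%N.
rewrite (big_cat_nat (n := 5)) ?leq_addl //= Eg5.
rewrite !big_nat_recl // big_geq // addr0.
have [g2 F2] := rootsum2_mod4 x y z; have [g3 F3] := rootsum3_mod2 x y z.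
have [g4 F4] := rootsum4_mod2 x y z.
rewrite -/N in F2 F3 F4.
have pw m : (m <= h)%N -> N ^+ (h - m) * N ^+ m = N ^+ h.
  by move=> mh; rewrite -exprD subnK.
have T0 : t 0%N = (6 * e 0%N)%:~R * N ^+ h.
  by rewrite /t rootsum0 subn0 !(rmorphM, rmorph_nat) /=; ring.
have T1 : t 1%N = (e 1%N)%:~R * N ^+ h by rewrite /t -mulrA -{2}[N]expr1 pw // ltnW.
have T2 : t 2%N = - (e 2%N)%:~R * N ^+ h
                  + (4 * D)%:~R * (q2%:~R * N ^+ (h - 2) * g2).
  rewrite /t F2 -(pw 2%N) // E2 !(rmorphM, rmorph_nat) /=; ring.
(* If h < 3, the truncated exponent breaks N^(h-3) N^3 = N^h, but then e_3 = 0. The same split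
   serves for index 4. *)
have T3 : exists g, t 3%N = (e 3%N)%:~R * N ^+ h + (4 * D)%:~R * g.
  case: (leqP 3 h) => h3.
    exists (q3%:~R * N ^+ (h - 3) * g3).
    by rewrite /t F3 -(pw 3%N) // E3 !(rmorphM, rmorph_nat) /=; ring.
  by exists 0; rewrite /t e0 // !mul0r mulr0 addr0.
have T4 : exists g, t 4%N = (e 4%N)%:~R * N ^+ h + (4 * D)%:~R * g.
  case: (leqP 4 h) => h4.
    exists (q4%:~R * N ^+ (h - 4) * g4).
    by rewrite /t F4 -(pw 4%N) // E4 !(rmorphM, rmorph_nat) /=; ring.
  by exists 0; rewrite /t e0 // !mul0r mulr0 addr0.
have {T3} [c3 ->] := T3; have {T4} [c4 ->] := T4; rewrite T0 T1 T2.
exists (q%:~R * N ^+ h + q2%:~R * N ^+ (h - 2) * g2 + c3 + c4 + g5).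
have := congr1 (fun k : int => k%:~R : R) Eq.
rewrite !(rmorphB, rmorphD, rmorphM, rmorph_nat) /= => /eqP.
rewrite subr_eq => /eqP EqR.
transitivity (((6 * e 0%N)%:~R + (e 1%N)%:~R - (e 2%N)%:~R + (e 3%N)%:~R
               + (e 4%N)%:~R) * N ^+ h
  + (4 * D)%:~R * (q2%:~R * N ^+ (h - 2) * g2 + c3 + c4 + g5)); first by ring.
by rewrite rmorphM /= EqR !(rmorphM, rmorph_nat) /=; ring.
Qed.
End RootSums.

(** * The coefficients e_m and their 2-adic divisibility for h from 2 to 20 *)

(** This is the vanishing of the coefficient of N^(h-m-1) S_m in Delta_Q T. *)
Definition zonal_recurrence (e : nat -> int) h :=
  forall m, (m < h)%N ->
    (m.+1 * m.*2.+1)%:R * e m.+1 = - ((h - m) * (h.*2 + m.*2).+1).*2%:R * e m.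

(* The divisions are exact: the m-th coefficient is (-2)^m 'C(h, m) times
   prod_(i < m) (2h+2i+1) * prod_(m <= i <= h) (2i+1). *)
Fixpoint zonal_coef h m : BinNums.Z :=
  if m is m'.+1 then
    BinInt.Z.div (- ((h - m') * (h.*2 + m'.*2).+1).*2%:R * zonal_coef h m')
                 (m'.+1 * m'.*2.+1)%:R
  else foldr (fun i p => i.*2.+1%:R * p) 1 (iota 0 h.+1).

Definition div_exact (d a : BinNums.Z) := a == BinInt.Z.div a d * d.

(** All is done in binary integers so that [vm_compute] can decide it. By the closed form, c_m is
    2^m 'C(h, m) times an odd integer, up to sign. For odd h, [D] is thus the exact power of 2 in
    c_2; for even h, 6 c_0 is 2 modulo 4 while c_1 and c_2 are multiples of 4, and D = 1 will do. *)
Definition zonal_check h : bool :=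
  let c := zonal_coef h in
  let D := 2%:R ^+ (if odd h then (logn 2 h.-1).+1 else 0) in
  [&& all (fun m => (m.+1 * m.*2.+1)%:R * c m.+1
             == - ((h - m) * (h.*2 + m.*2).+1).*2%:R * c m) (iota 0 h),
      div_exact (4%:R * D)
        (6%:R * c 0%N + c 1%N - c 2%N + c 3%N + c 4%N - 2%:R * D),
      div_exact D (c 2%N), div_exact (2%:R * D) (c 3%N),
      div_exact (2%:R * D) (c 4%N) &
      all (fun m => div_exact (4%:R * D) (c m)) (iota 5 (h - 4))].

Lemma zonal_checkT : all zonal_check (iota 2 19).
Proof. by vm_compute. Qed.

Lemma div_exactP d a : div_exact d a -> (int_of_Z d %| int_of_Z a)%Z.
Proof. by move=> /eqP ->; rewrite rmorphM dvdz_mull. Qed.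

Lemma zonal_coef_gt h m : (h < m)%N -> zonal_coef h m = 0.
Proof.
(* Unfolded, [h <= m] is [h - m == 0], which kills the numerator of the recursion. *)
case: m => // m; rewrite ltnS /= => /eqP->.
by rewrite mul0n double0 oppr0 mul0r Zdiv.Zdiv_0_l.
Qed.

Lemma zonal_coef_exists h : (2 <= h <= 20)%N ->
  exists D e, [/\ D != 0, forall m, (h < m)%N -> e m = 0,
                  zonal_recurrence e h & zonal_congruence D e h].
Proof.
move=> h2; have : zonal_check h.
  by apply: (allP zonal_checkT); rewrite mem_iota.
have := @zonal_coef_gt h; rewrite /zonal_check; move: (zonal_coef h) => c c0.
have : int_of_Z (2%:R ^+ (if odd h then (logn 2 h.-1).+1 else 0)) != 0.
  by rewrite rmorphXn rmorph_nat expf_neq0.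
move: (2%:R ^+ _) => D D0; case/and5P.
move=> /allP rec Dc /div_exactP D2 /div_exactP D3 /andP[/div_exactP D4 /allP Dm].
exists (int_of_Z D), (fun m => int_of_Z (c m)); split=> //.
- by move=> m /c0->; rewrite rmorph0.
- move=> m mh; have m_in : m \in iota 0 h by rewrite mem_iota.
  have /eqP/(congr1 int_of_Z) := rec m m_in.
  by rewrite !rmorphM rmorphN !rmorph_nat.
rewrite !rmorphM !rmorph_nat in D3 D4.
split=> //.
- apply/eqP; rewrite eqz_mod_dvd.
  by move/div_exactP: Dc; rewrite !(rmorphB, rmorphD, rmorphM, rmorph_nat).
move=> m /andP[m5 mh]; have : m \in iota 5 (h - 4).
  by rewrite mem_iota m5 -[5%N]/(1 + 4)%N -addnA subnKC // ltnW // (leq_trans m5).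
by move/Dm/div_exactP; rewrite rmorphM rmorph_nat.
Qed.

(** * The operator Delta_Q and the harmonicity of zonal sums *)

Local Notation P3 := {mpoly rat[3]}.

Local Notation X1 := ('X_(inord 0)).
Local Notation X2 := ('X_(inord 1)).
Local Notation X3 := ('X_(inord 2)).

Lemma sum3E (V : nmodType) (F : 'I_3 -> V) :
  \sum_(i < 3) F i = F (inord 0) + F (inord 1) + F (inord 2).
Proof.
rewrite !big_ord_recl big_ord0 addr0 addrA.
by congr (F _ + F _ + F _); apply: val_inj; rewrite /= inordK.
Qed.

Lemma laplQE (f : P3) :
  let d i g := g^`M(inord i) in
  laplQ f = 2%:R^-1 *: (d 0%N (d 0%N f) + d 1%N (d 1%N f) + d 2%N (d 2%N f)
    + (d 1%N (d 0%N f) + d 2%N (d 0%N f) + d 2%N (d 1%N f))).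
Proof.
rewrite /laplQ sum3E [X in _ + X]sum3E; congr (_ *: (_ + _)).
rewrite !(big_mkcond (fun j : 'I_3 => _ < j)%N) /=.
by rewrite !sum3E !inordK //= !add0r !addr0.
Qed.

(** The symmetric bilinear form on gradients that measures the failure of the Leibniz rule for
    Delta_Q. *)
Definition gradQ (f g : P3) : P3 :=
  let d i f := f^`M(inord i) in
  2%:R^-1 *: (2%:R * (d 0%N f * d 0%N g + d 1%N f * d 1%N g + d 2%N f * d 2%N g)
    + (d 0%N f * d 1%N g + d 1%N f * d 0%N g + d 0%N f * d 2%N g
       + d 2%N f * d 0%N g + d 1%N f * d 2%N g + d 2%N f * d 1%N g)).

(* Abstracting the derivatives keeps [ring] from comparing them by conversion. *)
Lemma laplQM f g : laplQ (f * g) = f * laplQ g + laplQ f * g + gradQ f g.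
Proof.
rewrite !laplQE /gradQ /= !(mderivM, mderivD) -!mul_mpolyC.
move: (_^-1%:MP) => c.
do 6!move: (mderiv _ (mderiv _ f)) (mderiv _ (mderiv _ g)) => ? ?.
do 3!move: (mderiv _ f) (mderiv _ g) => ? ?.
ring.
Qed.

Lemma gradQMl f g k : gradQ (f * g) k = f * gradQ g k + gradQ f k * g.
Proof.
rewrite /gradQ /= !mderivM -!mul_mpolyC; move: (_%:MP) => c.
do 3!move: (mderiv _ f) (mderiv _ g) (mderiv _ k) => ? ? ?.
ring.
Qed.

Lemma gradQC f g : gradQ f g = gradQ g f.
Proof.
rewrite /gradQ /=; congr (_ *: _).
do 3!move: (mderiv _ f) (mderiv _ g) => ? ?.
ring.
Qed.

Lemma gradQ1 f : gradQ 1 f = 0.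
Proof. by rewrite /gradQ /= -mpolyC1 !mderivC -!mul_mpolyC; ring. Qed.

Lemma laplQ1 : laplQ 1 = 0.
Proof. by rewrite laplQE /= -mpolyC1 !(mderivC, mderiv0) !addr0 scaler0. Qed.

Lemma gradQX f g n : gradQ (f ^+ n) g = n%:R * f ^+ n.-1 * gradQ f g.
Proof.
elim: n => [|n IHn]; first by rewrite expr0 gradQ1 !mul0r.
rewrite exprS gradQMl IHn; move: (gradQ f g) => c.
case: n {IHn} => [|n] /=; rewrite ?exprS ?[n.+2%:R]mulrS; ring.
Qed.

(** Second-order chain rule. The factor is 'C(n, 2) rather than n(n-1) because [gradQ f f] is twice
    the symbol of Delta_Q at the gradient of f. *)
Lemma laplQX f n : laplQ (f ^+ n) =
  n%:R * f ^+ n.-1 * laplQ f + ('C(n, 2))%:R * f ^+ n.-2 * gradQ f f.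
Proof.
elim: n => [|n IHn]; first by rewrite expr0 laplQ1 bin0n !mul0r addr0.
rewrite exprS laplQM IHn gradQC gradQX binS bin1 natrD.
move: (gradQ f f) (laplQ f) => c d.
case: n {IHn} => [|[|n]]; first by rewrite bin0n /=; ring.
  by rewrite bin_small //=; ring.
by move: 'C(n.+2, 2)%:R => b; rewrite /= [n.+3%:R]mulrS ?exprS; ring.
Qed.

Lemma mderivXU (i j : nat) : (i < 3)%N -> (j < 3)%N ->
  ('X_(inord j) : P3)^`M(inord i) = (i == j)%:R.
Proof.
move=> i3 j3; rewrite mderivX mnm1E -val_eqE /= !inordK // eq_sym.
case: eqP => [->|_]; last by rewrite scale0r.
by rewrite scale1r -{1}[U_(_)%MM]add0m addmK mpolyX0.
Qed.

Lemma laplQD f g : laplQ (f + g) = laplQ f + laplQ g.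
Proof.
rewrite !laplQE /= !mderivD -scalerDr; congr (_ *: _).
do 6!move: (mderiv _ (mderiv _ f)) (mderiv _ (mderiv _ g)) => ? ?.
by ring.
Qed.

Lemma laplQZ a f : laplQ (a *: f) = a *: laplQ f.
Proof. by rewrite !laplQE /= !mderivZ -!scalerDr !scalerA mulrC. Qed.

Lemma laplQB f g : laplQ (f - g) = laplQ f - laplQ g.
Proof. by rewrite -scaleN1r laplQD laplQZ scaleN1r. Qed.

Lemma gradQDl f g k : gradQ (f + g) k = gradQ f k + gradQ g k.
Proof.
rewrite /gradQ /= !mderivD -scalerDr; congr (_ *: _).
do 3!move: (mderiv _ f) (mderiv _ g) (mderiv _ k) => ? ? ?.
by ring.
Qed.

Lemma gradQNl f k : gradQ (- f) k = - gradQ f k.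
Proof.
rewrite /gradQ /= !mderivN -scalerN; congr (_ *: _).
do 3!move: (mderiv _ f) (mderiv _ k) => ? ?.
by ring.
Qed.

Lemma gradQXU (i j : nat) : (i < 3)%N -> (j < 3)%N ->
  gradQ 'X_(inord i) 'X_(inord j) = if i == j then 1 else (2%:R^-1)%:MP.
Proof.
move=> i3 j3; rewrite /gradQ /= !mderivXU //.
have -> : (if i == j then 1 else (2%:R^-1)%:MP) =
          2%:R^-1 *: (if i == j then 2%:R else 1) :> P3.
  case: ifP => _; last by rewrite -mul_mpolyC mulr1.
  by rewrite -scaler_nat scalerA mulVf ?scale1r.
congr (_ *: _).
by case: i i3 => [|[|[|]]] // _; case: j j3 => [|[|[|]]] // _ /=; ring.
Qed.

Lemma laplQXU (i : nat) : (i < 3)%N -> laplQ 'X_(inord i) = 0.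
Proof.
move=> i3; rewrite laplQE /= !mderivXU //.
have E (b : bool) j : (b%:R : P3)^`M(j) = 0.
  by case: b; rewrite ?mderiv0 // -mpolyC1 mderivC.
by rewrite !E !addr0 scaler0.
Qed.

Local Notation forms := (root_forms X1 X2 X3 : seq P3).
Local Notation NmQ := (rootsum X1 X2 X3 1 : P3).

(** The constant 1/2 is an opaque atom for [ring]; this relation is supplied to it by rewriting. *)
Lemma half_mpoly : 2%:R * (2%:R^-1)%:MP = 1 :> P3.
Proof. by rewrite mulr_natl -mpolyCMn -(mulr_natl 2%:R^-1) mulfV. Qed.

Lemma laplQ_form u : u \in forms -> laplQ u = 0.
Proof.
rewrite !inE => /or4P[/eqP->|/eqP->|/eqP->|/or3P[]/eqP->];
  by rewrite ?laplQB !laplQXU ?subr0.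
Qed.

(** The Gram matrix of the variables has 1 on the diagonal and 1/2 elsewhere, so the differences
    also have length 1 + 1 - 1 = 1. *)
Lemma gradQ_form u : u \in forms -> gradQ u u = 1.
Proof.
have H := half_mpoly.
rewrite !inE => /or4P[/eqP->|/eqP->|/eqP->|/or3P[]/eqP->];
  rewrite ?(gradQDl, gradQNl, gradQC _ (_ + _), gradQC _ (- _)) !gradQXU //=;
  by rewrite -H; ring.
Qed.

Lemma laplQ_sum (I : Type) (s : seq I) (F : I -> P3) :
  laplQ (\sum_(i <- s) F i) = \sum_(i <- s) laplQ (F i).
Proof.
apply: (big_morph laplQ laplQD).
by rewrite -[in LHS](scale0r 0) laplQZ scale0r.
Qed.

Lemma gradQ_suml (I : Type) (s : seq I) (F : I -> P3) g :
  gradQ (\sum_(i <- s) F i) g = \sum_(i <- s) gradQ (F i) g.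
Proof.
apply: (big_morph (gradQ^~ g)) => [f k|]; first exact: gradQDl.
have /eqP := gradQDl 0 0 g.
by rewrite addr0 eq_sym -subr_eq0 addrK => /eqP.
Qed.

Lemma laplQ_Nm : laplQ NmQ = 6%:R.
Proof.
rewrite /rootsum laplQ_sum big_seq_cond (eq_bigr (fun=> 1)); last first.
  move=> u /andP[uf _].
  by rewrite laplQX laplQ_form // gradQ_form // binn; ring.
by rewrite -big_seq_cond !big_cons big_nil; ring.
Qed.

(** The map sending v to the sum of the gradQ(u, v) u over the six forms is scalar of trace 6 in
    dimension 3, hence is 2; differentiating the squares u^2 doubles it. The proof checks this on
    the variables. *)
Lemma gradQ_Nm_form u : u \in forms -> gradQ NmQ u = 4%:R * u.
Proof.
have H := half_mpoly.
have E (i : nat) : (i < 3)%N -> gradQ NmQ 'X_(inord i) = 4%:R * 'X_(inord i).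
  move=> i3; rewrite /rootsum gradQ_suml !big_cons big_nil !gradQX.
  rewrite !(gradQDl, gradQNl) !gradQXU //.
  apply/eqP; rewrite -subr_eq0; apply/eqP.
  (* The difference is exhibited as a multiple of 1 - 2 (1/2), an identity valid with 1/2 replaced
     by any [c]. *)
  transitivity (2%:R * (1 - 2%:R * (2%:R^-1)%:MP)
                * (2%:R * 'X_(inord i) - X1 - X2 - X3) : P3).
    move: (_%:MP : P3) => c; rewrite -[1.*2]/2%N.
    by case: i i3 => [|[|[|]]] // _ /=; ring.
  by rewrite H subrr mulr0 mul0r.
rewrite !inE => /or4P[/eqP->|/eqP->|/eqP->|/or3P[]/eqP->];
  rewrite ?(gradQC _ (_ + _), gradQDl, gradQNl) -?(gradQC NmQ) ?E //; by ring.
Qed.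

Lemma gradQ_Nm : gradQ NmQ NmQ = 8%:R * NmQ.
Proof.
rewrite {1}/rootsum gradQ_suml [RHS]mulr_sumr !big_seq; apply: eq_bigr => u uf.
by rewrite gradQX gradQC gradQ_Nm_form // -[1.*2]/2%N /=; ring.
Qed.

(** The first coefficient collects 6k from Delta_Q N = 6, 4k(k-1) from gradQ(N, N) = 8N, and 8km
    from the cross term gradQ(N, u) = 4u. The second is 'C(2m, 2). Truncated exponents occur only
    with a zero coefficient. *)
Lemma laplQ_Nm_form k m u : u \in forms ->
  laplQ (NmQ ^+ k * u ^+ m.*2) =
    (2 * (k * (k.*2 + m.*2.*2).+1))%:R * (NmQ ^+ k.-1 * u ^+ m.*2)
  + (m * m.*2.-1)%:R * (NmQ ^+ k * u ^+ m.-1.*2).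
Proof.
move=> uf; rewrite laplQM gradQX (gradQC NmQ) gradQX (gradQC u) gradQ_Nm_form // !laplQX.
rewrite gradQ_form // gradQ_Nm laplQ_form // laplQ_Nm.
have -> : m.-1.*2 = m.*2.-2 by case: m.
have -> : 'C(m.*2, 2) = (m * m.*2.-1)%N by rewrite bin2 -mul2n -mulnA mul2n doubleK.
have -> : ('C(k, 2)%:R * NmQ ^+ k.-2 * (8%:R * NmQ) =
           4%:R * (k * k.-1)%:R * NmQ ^+ k.-1).
  have -> : (k * k.-1 = 2 * 'C(k, 2))%N.
    by rewrite bin2 mul2n halfK oddM; case: k => //= k; rewrite andNb subn0.
  rewrite natrM; case: k => [|[|k]].
  - by rewrite bin_small // mulr0n !(mul0r, mulr0).
  - by rewrite bin_small // mulr0n !(mul0r, mulr0).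
  by rewrite /= [NmQ ^+ k.+1]exprS; move: 'C(_, _)%:R => b; ring.
have -> : (2 * (k * (k.*2 + m.*2.*2).+1) = 6 * k + 4 * (k * k.-1) + 8 * (k * m))%N.
  by case: k => // k; rewrite -!muln2 /=; ring.
have E : k%:R * NmQ ^+ k.-1 * ((m.*2)%:R * u ^+ m.*2.-1 * (4%:R * u))
       = (8 * (k * m))%:R * (NmQ ^+ k.-1 * u ^+ m.*2).
  case: m => [|m]; first by rewrite double0 !muln0 mulr0n !mul0r mulr0.
  by rewrite doubleS /= [u ^+ _.+2]exprS -muln2; ring.
rewrite E !natrD; ring.
Qed.

Lemma laplQ_Nm_rootsum k m : laplQ (NmQ ^+ k * rootsum X1 X2 X3 m) =
    (2 * (k * (k.*2 + m.*2.*2).+1))%:R * (NmQ ^+ k.-1 * rootsum X1 X2 X3 m)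
  + (m * m.*2.-1)%:R * (NmQ ^+ k * rootsum X1 X2 X3 m.-1).
Proof.
have sumE (a b : P3) n :
    \sum_(u <- forms) a * (b * u ^+ n.*2) = a * (b * rootsum X1 X2 X3 n).
  by rewrite /rootsum -!mulr_sumr.
rewrite -!sumE -big_split.
transitivity (laplQ (\sum_(u <- forms) NmQ ^+ k * u ^+ m.*2)).
  by rewrite -mulr_sumr.
rewrite laplQ_sum !big_seq; apply: eq_bigr => u; exact: laplQ_Nm_form.
Qed.

Lemma laplQ_intl (c : int) f : laplQ (c%:~R * f) = c%:~R * laplQ f.
Proof. by rewrite !mulrzl -!scaler_int laplQZ. Qed.

Lemma zonalsum_harmonic e h :
  zonal_recurrence e h -> laplQ (zonalsum e h X1 X2 X3) = 0.
Proof.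
move=> rec; rewrite /zonalsum laplQ_sum.
(* [F m] comes from lowering the power of N in the term of index m, [G m] from lowering the power of
   u in the term of index m + 1. Both are multiples of N^(h-m-1) S_m, and the recurrence cancels
   them. *)
pose t m := NmQ ^+ (h - m.+1) * rootsum X1 X2 X3 m.
pose F m := (((h - m) * (h.*2 + m.*2).+1).*2%:R * e m)%:~R * t m.
pose G m := ((m.+1 * m.*2.+1)%:R * e m.+1)%:~R * t m.
have FG m : (m < h)%N -> F m = - G m.
  by move=> mh; rewrite /F /G rec // -mulNr -rmorphN mulNr opprK.
pose K m := if m is m'.+1 then G m' else 0.
transitivity (\sum_(m < h.+1) F m + \sum_(m < h.+1) K m).
  rewrite -big_split; apply: eq_bigr => -[m /=]; rewrite ltnS => mh _.
  rewrite -mulrA laplQ_intl laplQ_Nm_rootsum mulrDr /F /K /G /t; congr (_ + _).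
    have -> : ((h - m).*2 + m.*2.*2 = h.*2 + m.*2)%N.
      by rewrite -!doubleD -[m.*2]addnn addnA subnK.
    by rewrite rmorphM rmorph_nat -subnS mulrCA mulrA mul2n.
  case: m mh => [|m] mh; first by rewrite mul0n mulr0n mul0r mulr0.
  by rewrite rmorphM rmorph_nat mulrCA mulrA doubleS.
have Fh : F h = 0 by rewrite /F subnn mul0n mul0r rmorph0 mul0r.
rewrite big_ord_recr [X in _ + X]big_ord_recl /= Fh addr0 add0r.
by rewrite -big_split big1 //= => m _; rewrite FG // addNr.
Qed.

(** * Integral coordinates on the Hurwitz order; its elements of norm 1 and 2 *)

(* The quadruple (a, b, c, d) stands for the Hurwitz quaternion
   a + b i + c j + d w. *)
Definition hcoord : Type := int * int * int * int.

Definition hquat (t : hcoord) : quat :=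
  let: (a, b, c, d) := t in
  a%:~R + b%:~R * qi + c%:~R * qj + d%:~R * qw.

(** The structure constants come from ij = 2w - 1 - i - j. *)
Definition hmul (s t : hcoord) : hcoord :=
  let: (a, b, c, d) := s in let: (a', b', c', d') := t in
  (a * a' - b * b' - c * c' - b * c' + c * b' - b * d' - d * c' - d * d',
   a * b' + b * a' - b * c' + c * b' + d * b' + c * d' - d * c',
   a * c' + c * a' - b * c' + c * b' - b * d' + c * d' + d * b',
   a * d' + d * a' + 2 * b * c' - 2 * c * b' + b * d' + d * c' - c * d'
     - d * b' + d * d').

Definition hconj (t : hcoord) : hcoord :=
  let: (a, b, c, d) := t in (a + d, - b, - c, - d).

Definition hnorm (t : hcoord) : int :=
  let: (a, b, c, d) := t in
  a ^+ 2 + b ^+ 2 + c ^+ 2 + d ^+ 2 + d * (a + b + c).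

Definition hone : hcoord := (1, 0, 0, 0).

Lemma hquatE a b c d : hquat (a, b, c, d) =
  let h := d%:~R / 2%:R in mkq (a%:~R + h) (b%:~R + h) (c%:~R + h) h.
Proof.
rewrite /hquat /= !mulrzl -[a%:~R]/(1 *~ a) -!scaler_int.
rewrite /qw qcM qc1 /qi /qj; apply: qcP; split; rewrite /mulq /oneq;
  do ?qsimp; by field.
Qed.

Lemma hquatM s t : hquat (hmul s t) = hquat s * hquat t.
Proof.
case: s => [[[a b] c] d]; case: t => [[[a' b'] c'] d'].
rewrite /hmul !hquatE /= qcM /mulq; apply: qcP.
by split; do ?qsimp; rewrite !(rmorphD, rmorphB, rmorphM, rmorph_nat) /=; field.
Qed.

Lemma hquat1 : hquat hone = 1.
Proof. by rewrite /hquat /= !mul0r !addr0. Qed.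

Lemma hmul_conj t : hmul t (hconj t) = (hnorm t, 0, 0, 0).
Proof.
by case: t => [[[a b] c] d]; rewrite /hmul /hconj /hnorm; congr (_, _, _, _); ring.
Qed.

Lemma hconj_mul t : hmul (hconj t) t = (hnorm t, 0, 0, 0).
Proof.
by case: t => [[[a b] c] d]; rewrite /hmul /hconj /hnorm; congr (_, _, _, _); ring.
Qed.

Lemma hnorm_conj t : hnorm (hconj t) = hnorm t.
Proof. by case: t => [[[a b] c] d]; rewrite /hconj /hnorm; ring. Qed.

Lemma hnormM s t : hnorm (hmul s t) = hnorm s * hnorm t.
Proof.
case: s => [[[a b] c] d]; case: t => [[[a' b'] c'] d'].
by rewrite /hmul /hnorm; ring.
Qed.

Lemma sqn_hquat t : sqn (hquat t) = (hnorm t)%:~R.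
Proof.
case: t => [[[a b] c] d]; rewrite hquatE /sqn /hnorm /=; do ?qsimp.
by rewrite !(rmorphD, rmorphM, rmorphXn) /=; field.
Qed.

Lemma hnorm_ge0 t : 0 <= hnorm t.
Proof. by rewrite -(ler0z rat) -sqn_hquat /sqn !addr_ge0 ?sqr_ge0. Qed.

Lemma hquat_inj : injective hquat.
Proof.
move=> [[[a b] c] d] [[[a' b'] c'] d'] E.
have E3 := congr1 (qc 3) E; have E2 := congr1 (qc 2) E.
have E1 := congr1 (qc 1) E; have E0 := congr1 (qc 0) E.
rewrite !hquatE /= !mkqE //= in E0 E1 E2 E3.
move: E3 => /(mulIf _)/intr_inj; rewrite invr_eq0 => /(_ isT) Ed.
rewrite Ed in E0 E1 E2 *.
by move: E0 E1 E2 => /addIr/intr_inj-> /addIr/intr_inj-> /addIr/intr_inj->.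
Qed.

Lemma hurwitzP x : hurwitz x <-> exists t, x = hquat t.
Proof.
split=> [[a [b [c [d ->]]]]|[[[[a b] c] d] ->]]; first by exists (a, b, c, d).
by exists a, b, c, d.
Qed.

(** Norms are multiplicative nonnegative integers, so a unit has norm 1; conversely the conjugate is
    then the inverse. *)
Lemma hurwitz_unitsP x :
  hurwitz_units x <-> exists2 t, x = hquat t & hnorm t = 1.
Proof.
split=> [[/hurwitzP[t ->] [_ /hurwitzP[s ->] [E _]]]|[t -> Nt]].
  exists t => //; rewrite -hquatM -hquat1 in E.
  have := congr1 hnorm (hquat_inj E).
  rewrite hnormM -(gez0_abs (hnorm_ge0 s)) => /eqP.
  by rewrite intUnitRing.mulzn_eq1 => /andP[/eqP].
split; first by apply/hurwitzP; exists t.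
exists (hquat (hconj t)); first by apply/hurwitzP; exists (hconj t).
by rewrite -!hquatM hmul_conj hconj_mul Nt -[(1, 0, 0, 0)]/hone hquat1.
Qed.

Lemma hquat_neq0 t : hnorm t != 0 -> hquat t != 0.
Proof. by rewrite -sqn_eq0 sqn_hquat intr_eq0. Qed.

Definition small_ints : seq int := [:: -2; -1; 0; 1; 2].

Definition hbox : seq hcoord :=
  [seq (p, d) | p <- [seq (q, c) | q <- [seq (a, b) | a <- small_ints,
     b <- small_ints], c <- small_ints], d <- small_ints].

Lemma small_sqr (k : int) : k ^+ 2 <= 8 -> -2 <= k <= 2.
Proof. by nia. Qed.

Lemma small_intsP (k : int) : (k \in small_ints) = (-2 <= k <= 2).
Proof. by rewrite !inE; lia. Qed.

(** Four times the norm is d^2 + (2a+d)^2 + (2b+d)^2 + (2c+d)^2, so each of these squares is at most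
    8. *)
Lemma hnorm_small t : hnorm t <= 2 -> t \in hbox.
Proof.
case: t => [[[a b] c] d] N.
have le8 (p q r s : int) : p ^+ 2 + (q ^+ 2 + r ^+ 2 + s ^+ 2) <= 8 -> -2 <= p <= 2.
  by move=> H; apply/small_sqr/(le_trans _ H); rewrite lerDl !addr_ge0 ?sqr_ge0.
have E : d ^+ 2 + ((2 * a + d) ^+ 2 + (2 * b + d) ^+ 2 + (2 * c + d) ^+ 2) <= 8.
  rewrite (_ : _ + _ = 4 * hnorm (a, b, c, d)); last by rewrite /hnorm; ring.
  by move: N; lia.
have /andP[d1 d2] := le8 _ _ _ _ E.
have /andP[a1 a2] : -2 <= 2 * a + d <= 2.
  by apply: (le8 _ d (2 * b + d) (2 * c + d)); apply: le_trans E; lia.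
have /andP[b1 b2] : -2 <= 2 * b + d <= 2.
  by apply: (le8 _ d (2 * a + d) (2 * c + d)); apply: le_trans E; lia.
have /andP[c1 c2] : -2 <= 2 * c + d <= 2.
  by apply: (le8 _ d (2 * a + d) (2 * b + d)); apply: le_trans E; lia.
clear E N le8.
by do ![apply: (allpairs_f (fun x y => (x, y)))]; rewrite small_intsP; lia.
Qed.

Definition hi : hcoord := (0, 1, 0, 0).
Definition hj : hcoord := (0, 0, 1, 0).
Definition hw : hcoord := (0, 0, 0, 1).
Definition hopp1 : hcoord := (-1, 0, 0, 0).

(** The 24 units: the quaternion group of order 8 times the coset representatives 1, w, w^2. *)
Definition unit_words : seq hcoord :=
  [seq hmul u v | u <- [seq hmul r s | r <- [:: hone; hopp1],
                                       s <- [:: hone; hi; hj; hmul hi hj]],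
                  v <- [:: hone; hw; hmul hw hw]].

Lemma unit_wordsT :
  all (fun t => (hnorm t == 1) ==> (t \in unit_words)) hbox.
Proof. by vm_compute. Qed.

Lemma hunit_ind (P : hcoord -> Prop) :
    (forall s t, P s -> P t -> P (hmul s t)) ->
    P hopp1 -> P hi -> P hj -> P hw ->
  forall t, hnorm t = 1 -> P t.
Proof.
move=> PM Pn Pi Pj Pw t Nt.
have P1 : P hone by rewrite -[hone]/(hmul hopp1 hopp1); apply: PM.
have : t \in unit_words.
  have t2 : hnorm t <= 2 by rewrite Nt.
  by have := allP unit_wordsT t (hnorm_small t2); rewrite Nt eqxx.
case/allpairsP => -[u v] [/allpairsP[[r s] [rP sP ->]] vP ->].
apply: (PM); first apply: (PM).
- by move: rP; rewrite !inE => /orP[]/eqP->.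
- by move: sP; rewrite !inE => /or4P[]/eqP->; rewrite ?P1; auto.
by move: vP; rewrite !inE => /or3P[]/eqP->; auto.
Qed.

Definition honeDi : hcoord := (1, 1, 0, 0).

(** The prime 2 ramifies in D, so 1 + i generates the only ideal of norm 2; here this is verified by
    enumeration. *)
Lemma hnorm2T :
  all (fun t => (hnorm t == 2) ==>
         has (fun u => (hnorm u == 1) && (t == hmul u honeDi)) unit_words) hbox.
Proof. by vm_compute. Qed.

Lemma hnorm2_decomp t : hnorm t = 2 ->
  exists2 u, hnorm u = 1 & t = hmul u honeDi.
Proof.
move=> Nt; have t2 : hnorm t <= 2 by rewrite Nt.
have := allP hnorm2T t (hnorm_small t2); rewrite Nt eqxx.
by move=> /hasP[u _ /andP[/eqP Nu /eqP->]]; exists u.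
Qed.

(** * Matrices acting on polynomials, and the matrices F(g) of the generators *)

Lemma mpactXU (M : 'M[rat]_3) k :
  mpact M 'X_k = \sum_(i < 3) M i k *: 'X_i.
Proof. by rewrite /mpact comp_mpolyXU -tnth_nth tnth_mktuple. Qed.

Lemma mpact_sum (I : Type) (s : seq I) (F : I -> {mpoly rat[3]}) M :
  mpact M (\sum_(i <- s) F i) = \sum_(i <- s) mpact M (F i).
Proof. exact: raddf_sum. Qed.

Lemma mpactZ M a f : mpact M (a *: f) = a *: mpact M f.
Proof. exact: comp_mpolyZ. Qed.

Lemma mpact_prod (I : Type) (s : seq I) (F : I -> {mpoly rat[3]}) M :
  mpact M (\prod_(i <- s) F i) = \prod_(i <- s) mpact M (F i).
Proof. exact: rmorph_prod. Qed.

Lemma mpact_exp M f n : mpact M (f ^+ n) = mpact M f ^+ n.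
Proof. exact: rmorphXn. Qed.

(** Both sides are algebra morphisms in f, so it suffices to compare them on the variables. *)
Lemma mpactM M M' f : mpact (M *m M') f = mpact M (mpact M' f).
Proof.
have E k : mpact (M *m M') 'X_k = mpact M (mpact M' 'X_k).
  rewrite !mpactXU mpact_sum.
  under [RHS]eq_bigr => i _ do rewrite mpactZ mpactXU scaler_sumr.
  under [LHS]eq_bigr => i _ do rewrite mxE scaler_suml.
  rewrite exchange_big; apply: eq_bigr => i _.
  by apply: eq_bigr => j _; rewrite scalerA mulrC.
rewrite (mpolyE f) [LHS]mpact_sum (mpact_sum _ _ M') (mpact_sum _ _ M).
apply: eq_bigr => m _; rewrite [LHS]mpactZ (mpactZ M') (mpactZ M); congr (_ *: _).
rewrite mpolyXE_id [LHS]mpact_prod (mpact_prod _ _ M') (mpact_prod _ _ M).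
apply: eq_bigr => i _.
by rewrite [LHS]mpact_exp (mpact_exp M') (mpact_exp M) E.
Qed.

Lemma mpact1 f : mpact 1%:M f = f.
Proof.
rewrite -[RHS]comp_mpoly_id /mpact; congr (_ \mPo _); apply: eq_mktuple => j.
rewrite (bigD1 j) //= mxE eqxx scale1r big1 ?addr0 // => i ij.
by rewrite mxE (negbTE ij) scale0r.
Qed.

Lemma mx_eq_act (A B : 'M[rat]_3) : (forall x : 'rV_3, x *m A = x *m B) -> A = B.
Proof. by move=> AB; apply/row_matrixP => i; rewrite !rowE AB. Qed.

(** Conjugation is restated without g^-1, so that an explicit F(g) is checked by a polynomial
    identity. *)
Lemma Fmx_unique (g : quat) (M : 'M[rat]_3) :
  g != 0 -> (forall x, g * vecV (x *m M) = vecV x * g) -> Fmx g = M.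
Proof.
move=> g0 gM; apply: mx_eq_act => x; apply: (can_inj vecVK).
by rewrite Fmx_act // -mulrA -gM mulKr.
Qed.

Lemma Fmx_mul (g h : quat) : g != 0 -> h != 0 -> Fmx (g * h) = Fmx g *m Fmx h.
Proof.
move=> g0 h0; have gh0 : g * h != 0.
  have : g * h \is a GRing.unit by rewrite unitrMl.
  by apply: contraTneq => ->; rewrite unitr0.
apply: Fmx_unique => // x; rewrite mulmxA Fmx_act // Fmx_act // !mulrA.
by rewrite mulrK // mulrV // mul1r.
Qed.

Definition mx3 (s : seq (seq rat)) : 'M[rat]_3 :=
  \matrix_(i < 3, j < 3) (nth [::] s i)`_j.

Lemma mpact_mx3 s (k : nat) : (k < 3)%N ->
  mpact (mx3 s) 'X_(inord k) = (nth [::] s 0)`_k *: X1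
    + (nth [::] s 1)`_k *: X2 + (nth [::] s 2)`_k *: X3.
Proof.
by move=> k3; rewrite mpactXU sum3E !mxE !inordK.
Qed.

Lemma mulmx_mx3 (x : 'rV_3) s (k : nat) : (k < 3)%N ->
  (x *m mx3 s) 0 (inord k) = x 0 (inord 0) * (nth [::] s 0)`_k
    + x 0 (inord 1) * (nth [::] s 1)`_k + x 0 (inord 2) * (nth [::] s 2)`_k.
Proof. by move=> k3; rewrite mxE sum3E !mxE !inordK. Qed.

Ltac prove_Fmx :=
  apply: Fmx_unique; [by apply: hquat_neq0 |];
  move=> x; rewrite hquatE /= !vecVE !mulmx_mx3 //= !qcM; apply: qcP;
  split; rewrite /mulq; do ?qsimp; field.

Lemma Fmx_hi :
  Fmx (hquat hi) = mx3 [:: [:: -1; -1; -1]; [:: 0; 0; 1]; [:: 0; 1; 0]].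
Proof. by prove_Fmx. Qed.

Lemma Fmx_hj :
  Fmx (hquat hj) = mx3 [:: [:: 0; 0; 1]; [:: -1; -1; -1]; [:: 1; 0; 0]].
Proof. by prove_Fmx. Qed.

Lemma Fmx_hw :
  Fmx (hquat hw) = mx3 [:: [:: 0; 0; 1]; [:: 1; 0; 0]; [:: 0; 1; 0]].
Proof. by prove_Fmx. Qed.

Lemma Fmx_honeDi :
  Fmx (hquat honeDi) = mx3 [:: [:: 0; -1; 0]; [:: 1; 1; 1]; [:: -1; 0; 0]].
Proof. by prove_Fmx. Qed.

Lemma Fmx_hopp1 : Fmx (hquat hopp1) = 1%:M.
Proof.
apply: Fmx_unique; first exact: hquat_neq0.
by move=> x; rewrite mulmx1 /hquat /= !mul0r !addr0 mulN1r mulrN1.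
Qed.

(** * Invariance of zonal sums under the units and under F(1 + i) *)

Section RootSymmetry.
Variable R : comNzRingType.
Implicit Types x y z : R.

Lemma eq_even_pow x y m : x ^+ 2 = y ^+ 2 -> x ^+ m.*2 = y ^+ m.*2.
Proof. by rewrite -!mul2n !exprM => ->. Qed.

(** The arguments are the images of x, y, z under F(i). The six forms are permuted up to sign, which
    even powers ignore; the next three lemmas do the same for j, w and 1 + i. *)
Lemma rootsum_hi x y z m : rootsum (- x) (z - x) (y - x) m = rootsum x y z m.
Proof.
rewrite /rootsum !big_cons big_nil.
rewrite (@eq_even_pow (- x) x); last by ring.
rewrite (@eq_even_pow (y - x) (x - y)); last by ring.
rewrite (@eq_even_pow (- x - (z - x)) z); last by ring.
rewrite (@eq_even_pow (z - x - (y - x)) (y - z)); last by ring.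
by rewrite (@eq_even_pow (y - x - - x) y); ring.
Qed.

Lemma rootsum_hj x y z m : rootsum (z - y) (- y) (x - y) m = rootsum x y z m.
Proof.
rewrite /rootsum !big_cons big_nil.
rewrite (@eq_even_pow (- y) y); last by ring.
rewrite (@eq_even_pow (z - y) (y - z)); last by ring.
rewrite (@eq_even_pow (z - y - - y) z); last by ring.
rewrite (@eq_even_pow (- y - (x - y)) x); last by ring.
by rewrite (@eq_even_pow (x - y - (z - y)) (z - x)); ring.
Qed.

Lemma rootsum_hw x y z m : rootsum y z x m = rootsum x y z m.
Proof. by rewrite /rootsum !big_cons big_nil; ring. Qed.

Lemma rootsum_honeDi x y z m :
  rootsum (y - z) (y - x) y m = rootsum x y z m.
Proof.
rewrite /rootsum !big_cons big_nil.
rewrite (@eq_even_pow (y - x) (x - y)); last by ring.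
rewrite (@eq_even_pow (y - z - (y - x)) (z - x)); last by ring.
rewrite (@eq_even_pow (y - x - y) x); last by ring.
by rewrite (@eq_even_pow (y - (y - z)) z); ring.
Qed.

Lemma eq_zonalsum e h x y z x' y' z' :
    (forall m, rootsum x' y' z' m = rootsum x y z m) ->
  zonalsum e h x' y' z' = zonalsum e h x y z.
Proof.
by move=> E; rewrite /zonalsum E; apply: eq_bigr => m _; rewrite E.
Qed.

Lemma rmorph_rootsum (S : comNzRingType) (f : {rmorphism R -> S}) x y z m :
  f (rootsum x y z m) = rootsum (f x) (f y) (f z) m.
Proof.
by rewrite /rootsum !big_cons !big_nil !(rmorphB, rmorphD, rmorphXn) rmorph0.
Qed.

(** Serves both for the substitutions [mpact M] and for the passage from integer to rational
    coefficients. *)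
Lemma rmorph_zonalsum (S : comNzRingType) (f : {rmorphism R -> S}) e h x y z :
  f (zonalsum e h x y z) = zonalsum e h (f x) (f y) (f z).
Proof.
rewrite /zonalsum rmorph_sum; apply: eq_bigr => m _.
by rewrite !rmorphM rmorphXn rmorph_int !rmorph_rootsum.
Qed.

End RootSymmetry.

Local Notation zonalQ e h := (zonalsum e h X1 X2 X3 : {mpoly rat[3]}).

Lemma mpact_zonalsum M e h :
  mpact M (zonalQ e h) = zonalsum e h (mpact M X1) (mpact M X2) (mpact M X3).
Proof. exact: rmorph_zonalsum. Qed.

Section Invariance.
Variables (e : nat -> int) (h : nat).

(** The nonzero norm is carried along because multiplicativity of F requires it. *)
Definition zonal_inv (t : hcoord) :=
  hnorm t != 0 /\ mpact (Fmx (hquat t)) (zonalQ e h) = zonalQ e h.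

Lemma zonal_inv_mul s t : zonal_inv s -> zonal_inv t -> zonal_inv (hmul s t).
Proof.
move=> [Ns Es] [Nt Et]; split; first by rewrite hnormM mulf_neq0.
by rewrite hquatM Fmx_mul ?hquat_neq0 // mpactM Et Es.
Qed.

Lemma mpact_mx3E (a b c a' b' c' a'' b'' c'' : rat) :
  let M := mx3 [:: [:: a; b; c]; [:: a'; b'; c']; [:: a''; b''; c'']] in
  [/\ mpact M X1 = a *: X1 + a' *: X2 + a'' *: X3,
      mpact M X2 = b *: X1 + b' *: X2 + b'' *: X3 &
      mpact M X3 = c *: X1 + c' *: X2 + c'' *: X3].
Proof. by rewrite /= !mpact_mx3. Qed.

Let scaleE := (scale0r, scale1r, scaleN1r, add0r, addr0).

Lemma zonal_inv_hi : zonal_inv hi.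
Proof.
split=> //; rewrite Fmx_hi mpact_zonalsum.
case: (mpact_mx3E (-1) (-1) (-1) 0 0 1 0 1 0) => -> -> ->; rewrite !scaleE.
by apply: eq_zonalsum => m; rewrite ![- X1 + _]addrC rootsum_hi.
Qed.

Lemma zonal_inv_hj : zonal_inv hj.
Proof.
split=> //; rewrite Fmx_hj mpact_zonalsum.
case: (mpact_mx3E 0 0 1 (-1) (-1) (-1) 1 0 0) => -> -> ->; rewrite !scaleE.
by apply: eq_zonalsum => m; rewrite ![- X2 + _]addrC rootsum_hj.
Qed.

Lemma zonal_inv_hw : zonal_inv hw.
Proof.
split=> //; rewrite Fmx_hw mpact_zonalsum.
case: (mpact_mx3E 0 0 1 1 0 0 0 1 0) => -> -> ->; rewrite !scaleE.
by apply: eq_zonalsum => m; rewrite rootsum_hw.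
Qed.

Lemma zonal_inv_honeDi : zonal_inv honeDi.
Proof.
split=> //; rewrite Fmx_honeDi mpact_zonalsum.
case: (mpact_mx3E 0 (-1) 0 1 1 1 (-1) 0 0) => -> -> ->; rewrite !scaleE.
by apply: eq_zonalsum => m; rewrite ![- X1 + _]addrC rootsum_honeDi.
Qed.

Lemma zonal_inv_unit t : hnorm t = 1 -> zonal_inv t.
Proof.
apply: hunit_ind; [exact: zonal_inv_mul | | exact: zonal_inv_hi
  | exact: zonal_inv_hj | exact: zonal_inv_hw].
by split=> //; rewrite Fmx_hopp1 mpact1.
Qed.

End Invariance.

(** * The single coset in T_2 *)

Lemma GammaP g :
  Gamma g <-> exists2 t, g = Fmx (hquat t) & hnorm t = 1.
Proof.
split=> [[x /hurwitz_unitsP[t -> Nt] <-]|[t -> Nt]]; first by exists t.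
by exists (hquat t) => //; apply/hurwitz_unitsP; exists t.
Qed.

Lemma gcoset_honeDi t : hnorm t = 2 ->
  gcoset (Fmx (hquat t)) = gcoset (Fmx (hquat honeDi)).
Proof.
move=> /hnorm2_decomp[u Nu ->].
have F s : hnorm s = 1 -> Fmx (hquat s) *m Fmx (hquat u) = Fmx (hquat (hmul s u)).
  by move=> Ns; rewrite hquatM Fmx_mul // hquat_neq0 ?Nu ?Ns.
rewrite hquatM Fmx_mul ?hquat_neq0 ?Nu //.
apply/seteqP; split=> _ [_ /GammaP[s -> Ns] <-].
  exists (Fmx (hquat (hmul s u))); last by rewrite -F // mulmxA.
  by apply/GammaP; exists (hmul s u); rewrite ?hnormM ?Ns ?Nu ?mulr1.
(* As u has norm 1, [hconj u] is its inverse. *)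
have Nsu : hnorm (hmul s (hconj u)) = 1 by rewrite hnormM hnorm_conj Ns Nu.
exists (Fmx (hquat (hmul s (hconj u)))).
  by apply/GammaP; exists (hmul s (hconj u)).
rewrite mulmxA F // !hquatM -mulrA -hquatM hconj_mul Nu.
by rewrite -[(1, 0, 0, 0)]/hone hquat1 mulr1.
Qed.

Lemma frakT2_cosets :
  (gcoset @` frakT2)%classic = [set gcoset (Fmx (hquat honeDi))]%classic.
Proof.
apply/seteqP; split=> [_ [_ [y [/hurwitzP[t ->] Ny] <-] <-]|_ ->] /=.
  apply: gcoset_honeDi; move: Ny; rewrite qNmE sqn_hquat.
  move=> /(congr1 (qc 0)); rewrite qcZ -scaler_nat qcZ qc1 /oneq mkqE // !mulr1.
  by move=> /(@intr_inj rat _ 2).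
exists (Fmx (hquat honeDi)) => //; exists (hquat honeDi) => //; split.
  by apply/hurwitzP; exists honeDi.
by rewrite qNmE sqn_hquat -[RHS]scaler_nat.
Qed.

Lemma Fmx_hquat_unit t : hnorm t != 0 -> Fmx (hquat t) \in unitmx.
Proof.
move=> Nt; have t0 := hquat_neq0 Nt.
have tV0 : (hquat t)^-1 != 0.
  have : (hquat t)^-1 \is a GRing.unit by rewrite unitrV.
  by apply: contraTneq => ->; rewrite unitr0.
suff : Fmx (hquat t) *m Fmx (hquat t)^-1 = 1%:M by case/mulmx1_unit.
rewrite -Fmx_mul // mulrV //; apply: Fmx_unique; first exact: oneq_neq0.
by move=> x; rewrite mulmx1 mul1r mulr1.
Qed.

Lemma hecke2_inv f :
    (forall g, Gamma g -> mpact g f = f) -> mpact (Fmx (hquat honeDi)) f = f ->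
  hecke2 f = f.
Proof.
move=> fG fi; rewrite /hecke2 frakT2_cosets fsbig_set1.
(* The coset contains F(1 + i), so [xget] returns one of its elements and not the default [1%:M]. *)
set C := gcoset _; have : C (xget 1%:M C).
  apply: (@xgetPex _ 1%:M C); exists (Fmx (hquat honeDi)).
  exists 1%:M; last by rewrite mul1mx.
  by apply/GammaP; exists hopp1; rewrite ?Fmx_hopp1.
case=> v vG <-; have /GammaP[u Eu Nu] := vG; set M := _ *m _.
have fM : mpact M f = f by rewrite mpactM fi fG.
(* The chosen representative fixes f, hence so does its inverse. *)
rewrite -{1}fM -mpactM mulVmx ?mpact1 // unitmx_mul Eu.
by rewrite !Fmx_hquat_unit ?Nu.
Qed.

(** * Homogeneity, integrality and conclusion *)

Lemma dhomog_rootsum (x y z : {mpoly rat[3]}) m :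
    x \is 1.-homog -> y \is 1.-homog -> z \is 1.-homog ->
  rootsum x y z m \is m.*2.-homog.
Proof.
move=> hx hy hz; rewrite /rootsum big_seq; apply: rpred_sum => u.
have hB p q : p \is 1.-homog -> q \is 1.-homog -> p - q \is 1.-homog.
  exact: rpredB.
have hpow p : p \is 1.-homog -> p ^+ m.*2 \is m.*2.-homog.
  by move=> hp; have := dhomogMn m.*2 hp; rewrite mul1n.
by rewrite !inE => /or4P[/eqP->|/eqP->|/eqP->|/or3P[]/eqP->];
  apply: hpow; rewrite ?hB.
Qed.

Lemma dhomog_zonalsum e h :
  (zonalsum e h X1 X2 X3 : {mpoly rat[3]}) \is h.*2.-homog.
Proof.
have hX i : ('X_i : {mpoly rat[3]}) \is 1.-homog by rewrite dhomogX /= mdeg1.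
rewrite /zonalsum; apply: rpred_sum => -[m /=]; rewrite ltnS => mh _.
rewrite -mulrA mulrzl rpredMz //.
have -> : h.*2 = (1.*2 * (h - m) + m.*2)%N by rewrite mul2n -doubleD subnK.
by apply: dhomogM; rewrite ?dhomogMn ?dhomog_rootsum.
Qed.

Lemma map_zonalsum e h :
  map_mpoly intr (zonalsum e h X1 X2 X3) = zonalsum e h X1 X2 X3 :> {mpoly rat[3]}.
Proof.
apply: etrans (rmorph_zonalsum (map_mpoly intr) e h _ _ _) _.
by congr (zonalsum _ _ _ _ _); apply: map_mpolyX.
Qed.

Theorem theorem3 (l : nat) (hl : (4 <= l <= 40)%N) (hev : ~~ odd l) :
  exists f : {mpoly int[3]},
    harmonicGplus l (map_mpoly intr f) /\
    forall m : 'X_{1..3}, (f@_m = (NmZ ^+ (l %/ 2)%N)@_m %[mod 2])%Z.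
Proof.
pose h := (l %/ 2)%N.
have lh : l = h.*2 by rewrite -muln2 divnK // dvdn2.
have h2 : (2 <= h <= 20)%N by move: hl; rewrite lh !(@leq_double 2, @leq_double _ 20).
have [D [e [D0 e0 rec cong]]] := zonal_coef_exists h2.
have /andP[h_ge2 _] := h2.
have [g Eg] := zonalsum_mod (X1 : {mpoly int[3]}) X2 X3 h_ge2 e0 cong.
have EN : NmZ = rootsum X1 X2 X3 1 by rewrite rootsum1 /NmZ.
(* This is T / (2 D), read off from T = 2 D N^h + 4 D g. *)
exists (NmZ ^+ h + 2%:R * g); split; last first.
  move=> m; rewrite -/h; apply/eqP; rewrite eqz_mod_dvd mulr_natl mcoeffD mcoeffMn.
  by apply/dvdzP; exists g@_m; rewrite addrC addKr -[_ *+ 2]mulr_natr.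
have c0 : (2 * D)%:~R != 0 :> rat by rewrite intr_eq0 mulf_neq0.
have E : map_mpoly intr (NmZ ^+ h + 2%:R * g) =
    ((2 * D)%:~R)^-1 *: zonalsum e h X1 X2 X3 :> {mpoly rat[3]}.
  (* Multiplying by 2 D reduces the claim to an identity over the integers. *)
  apply: (scalerI c0); rewrite scalerA mulfV // scale1r scaler_int -raddfMz.
  apply: etrans (map_zonalsum e h); congr (map_mpoly _ _).
  by rewrite Eg -mulrzl EN !(rmorphM, rmorph_nat) /=; ring.
rewrite E.
have gammaI a g' : Gamma g' ->
    mpact g' (a *: zonalsum e h X1 X2 X3) = a *: zonalsum e h X1 X2 X3.
  by move=> /GammaP[t -> Nt]; rewrite mpactZ; case: (zonal_inv_unit e h Nt) => _ ->.
split; first split=> [|g' /gammaI//].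
  split; last by rewrite laplQZ zonalsum_harmonic ?scaler0.
  by rewrite lh; apply/dhomogZ/dhomog_zonalsum.
rewrite -signr_odd (negbTE hev) expr0 scale1r; apply: hecke2_inv => [g' /gammaI//|].
by rewrite mpactZ; case: (zonal_inv_honeDi e h) => _ ->.
Qed.
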